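(* Let $n\ge1$, let $k\ge2$ be odd, $\mathbb{K}\in\{\mathbb{R},\mathbb{C}\}$, $\star\in\{H,T\}$, $\epsilon_1,\epsilon_2\in\{1,-1\}$, $\epsilon=\epsilon_1\epsilon_2$. Let $0\le l<kn$, $X=[X_F,X_\infty]\in\mathbb{K}^{n\times kn}$ with $X_F\in\mathbb{K}^{n\times l}$, and $J=\mathrm{diag}(J_F^{-1},J_\infty)\in\mathbb{K}^{kn\times kn}$, where $J_F\in\mathbb{K}^{l\times l}$ is nonsingular and $J_\infty\in\mathbb{K}^{(kn-l)\times(kn-l)}$ is a Jordan matrix whose only eigenvalue is $0$. Then $(X,J)$ is a standard pair of the reversal $Q(\mu)=\mu^kA_0+\mu^{k-1}A_1+\cdots+\mu A_{k-1}+A_k$ of a $(\star,\epsilon_1,\epsilon_2)$-structured matrix polynomial $P(\lambda)=\sum_{j=0}^k\lambda^jA_j$ over $\mathbb{K}$ with $A_0$ nonsingular and $A_k$ singular if and only if $X_L$ is nonsingular and there exists a nonsingular $\mathcal{T}\in\mathbb{K}^{kn\times kn}$ such that $\mathcal{T}\in\mathcal{D}_{(J,\star,\epsilon_1,\epsilon_2)}$, $XJ^{k-1}\mathcal{T}X^\star$ is nonsingular, and $$XJ^r\mathcal{T}X^\star=0,\qquad r=0,1,\ldots,k-2.$$ In this case, for such a $\mathcal{T}$, the coefficient matrices can be expressed as $$A_0=(XJ^{k-1}\mathcal{T}X^\star)^{-1},\qquad A_{k-j}=-\sum_{i=j+1}^kA_{k-i}XJ^{k-j+i-1}\mathcal{T}X^\star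 A_0,\quad j=k-1,k-2,\ldots,0.$$ (That is: if $(X,J)$ is a standard pair of such a $Q$, then some such $\mathcal{T}$ yields the $A_j$ by these formulas; conversely, for any such $\mathcal{T}$, with $X_L$ nonsingular, the formulas define such a $Q$ having $(X,J)$ as a standard pair.)
   Context: $A^H$ and $A^T$ denote the conjugate transpose and the transpose; $A^\star$ is whichever is selected by $\star$. A matrix polynomial $P(\lambda)=\sum_{j=0}^k\lambda^jA_j$ with $A_j\in\mathbb{K}^{n\times n}$ is $(\star,\epsilon_1,\epsilon_2)$-structured if $A_j^\star=\epsilon_1A_j$ for even $j$ and $A_j^\star=\epsilon_2A_j$ for odd $j$. $X_L\in\mathbb{K}^{kn\times kn}$ is obtained by stacking $X,XJ,\ldots,XJ^{k-1}$ (top to bottom). $(X,J)$ is a standard pair of $Q(\mu)$ if $X_L$ is nonsingular and $A_0XJ^k+A_1XJ^{k-1}+\cdots+A_{k-1}XJ+A_kX=0$. (Here $(X_F,J_F)$ plays the role of the finite and $(X_\infty,J_\infty)$ of the infinite standard pair of $P$.) For $\Phi\in\mathbb{K}^{m\times m}$, $\mathcal{D}_{(\Phi,\star,\epsilon_1,\epsilon_2)}=\{S\in\mathbb{K}^{m\times m}: S^\star=\epsilon_1S,\ S\Phi^\star=\epsilon\,\Phi S\}$. *)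

(* Defs.v *)
From HB Require Import structures.
From mathcomp Require Import all_boot all_order all_algebra.
From mathcomp Require Import complex reals.

Set Implicit Arguments.
Unset Strict Implicit.
Unset Printing Implicit Defensive.

Import Order.TTheory GRing.Theory Num.Theory.
Local Open Scope ring_scope.

Variant base_field := RealBase | ComplexBase.

Definition scalar_field (R : realType) (b : base_field) : numFieldType :=
  match b with
  | RealBase => R : numFieldType
  | ComplexBase => R[i] : numFieldType
  end.

Definition conj_scalar (R : realType) (b : base_field) :
    scalar_field R b -> scalar_field R b :=
  match b return scalar_field R b -> scalar_field R b with
  | RealBase => id
  | ComplexBase => @conjc R
  end.

Variant star_kind := Hermitian | Transpose.

Definition star (R : realType) (b : base_field) (s : star_kind) (m n : nat)
    (A : 'M[scalar_field R b]_(m, n)) : 'M[scalar_field R b]_(n, m) :=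
  match s with
  | Hermitian => map_mx (@conj_scalar R b) A^T
  | Transpose => A^T
  end.

(* A matrix polynomial of grade k is the family of its k + 1 coefficients
   (coefficient j multiplies the j-th power of the variable); the coefficient
   of index k is allowed to vanish. *)
Definition matpoly (K : Type) (k n : nat) := {ffun 'I_k.+1 -> 'M[K]_n}.

Definition structured (R : realType) (b : base_field) (s : star_kind)
    (e1 e2 : scalar_field R b) (k n : nat) (A : matpoly (scalar_field R b) k n) : Prop :=
  forall j : 'I_k.+1, star s (A j) = (if odd j then e2 else e1) *: A j.

Definition reversal (K : Type) (k n : nat) (A : matpoly K k n) :
    matpoly K k n := [ffun j => A (rev_ord j)].

Lemma sum_block_sizes (k n : nat) : (\sum_(i < k) n = k * n)%N.
Proof. by rewrite sum_nat_const card_ord. Qed.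

Definition stackL (K : fieldType) (k n : nat)
    (X : 'M[K]_(n, k * n)) (J : 'M[K]_(k * n)) : 'M[K]_(k * n) :=
  castmx (sum_block_sizes k n, erefl (k * n)%N)
    (\mxcol_(i < k) (X *m J ^+ i)).

Definition standard_pair (K : fieldType) (k n : nat)
    (X : 'M[K]_(n, k * n)) (J : 'M[K]_(k * n)) (Q : matpoly K k n) : Prop :=
  stackL X J \in unitmx /\ \sum_(i < k.+1) Q i *m X *m J ^+ i = 0.

Definition jordan_block (K : fieldType) (a : K) (p : nat) : 'M[K]_p :=
  \matrix_(i, j) (if j == i then a else (j == i.+1 :> nat)%:R).

Definition jordan_matrix (K : fieldType) (m : nat) (A : 'M[K]_m) : Prop :=
  exists (s : nat) (p : 'I_s -> nat) (a : 'I_s -> K)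
         (eq_m : (\sum_(i < s) p i = m)%N),
    (forall i, 0 < p i)%N /\
    A = castmx (eq_m, eq_m) (\mxdiag_(i < s) jordan_block (a i) (p i)).

(* The set D_(Phi, star, e1, e2). *)
Definition inD (R : realType) (b : base_field) (s : star_kind)
    (e1 e2 : scalar_field R b) (m : nat) (Phi S : 'M[scalar_field R b]_m) : Prop :=
  star s S = e1 *: S /\ S *m star s Phi = (e1 * e2) *: (Phi *m S).

Definition admissible (R : realType) (b : base_field) (s : star_kind)
    (e1 e2 : scalar_field R b) (k n : nat) (X : 'M[scalar_field R b]_(n, k * n))
    (J T : 'M[scalar_field R b]_(k * n)) : Prop :=
  [/\ T \in unitmx,
      inD s e1 e2 J T,
      X *m J ^+ (k - 1) *m T *m star s X \in unitmx &
      forall r : nat, (r <= k - 2)%N -> X *m J ^+ r *m T *m star s X = 0].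

Definition solves_inverse_problem (R : realType) (b : base_field)
    (s : star_kind) (e1 e2 : scalar_field R b) (k n : nat)
    (X : 'M[scalar_field R b]_(n, k * n)) (J : 'M[scalar_field R b]_(k * n))
    (A : matpoly (scalar_field R b) k n) : Prop :=
  [/\ structured s e1 e2 A,
      A ord0 \in unitmx,
      A ord_max \notin unitmx &
      standard_pair X J (reversal A)].

(* Since rev_ord i = k - i in 'I_k.+1, A (rev_ord i) is the coefficient
   A_(k-i); the index j ranges over 0, ..., k-1. *)
Definition coefficient_formulas (R : realType) (b : base_field)
    (s : star_kind) (k n : nat)
    (X : 'M[scalar_field R b]_(n, k * n)) (J T : 'M[scalar_field R b]_(k * n))
    (A : matpoly (scalar_field R b) k n) : Prop :=
  A ord0 = invmx (X *m J ^+ (k - 1) *m T *m star s X) /\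
  forall j : 'I_k.+1, (j < k)%N ->
    A (rev_ord j) = - \sum_(i < k.+1 | (j < i)%N)
      A (rev_ord i) *m X *m J ^+ (k - j + i - 1) *m T *m star s X *m A ord0.

(* Main.v *)
(* Write Q_i = A_(k-i) for the coefficients of the reversal, with Q_i = 0 for
   i > k, let eps = e1 * e2 and let A' denote star A.
   Given Q, the matrix
     G = sum_(i, j < k) eps^i (J')^i X' Q_(i+j+1) X J^j
   satisfies G' = e1 G and, by telescoping, J' G = eps G J; if Y solves
   X J^r Y = 0 for r < k - 1 and X J^(k-1) Y = A_0^-1, then G Y = X', so G is
   invertible and T = G^-1 is admissible with T X' = Y.
   Conversely, for an admissible T the columns of the J^i T X', i < k, span the
   space, and testing sum_i Q_i X J^i = 0 against them gives the coefficient
   formulas.  The Markov parameters X J^r T X' are e1 eps^r-symmetric, hence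
   both Q and its structured transpose invert the Laurent series they define,
   and a two-sided inverse is unique.  Finally A_k is singular because
   it kills X v for every v in the kernel of J. *)

From HB Require Import structures.
Require Import Defs.
From mathcomp Require Import all_boot all_order all_algebra.
From mathcomp Require Import complex reals ring zify.

Set Implicit Arguments.
Unset Strict Implicit.
Unset Printing Implicit Defensive.

Import Order.TTheory GRing.Theory Num.Theory.
Local Open Scope ring_scope.

(** * Matrix powers and signs *)

Lemma mxexprD (K : fieldType) (m : nat) (J : 'M[K]_m) (a b : nat) :
  J ^+ (a + b) = J ^+ a *m J ^+ b.
Proof. by rewrite exprD mulmxE. Qed.

Lemma mxexprSr (K : fieldType) (m : nat) (J : 'M[K]_m) (a : nat) :
  J ^+ a.+1 = J ^+ a *m J.
Proof. by rewrite exprSr mulmxE. Qed.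

Lemma mxexprS (K : fieldType) (m : nat) (J : 'M[K]_m) (a : nat) :
  J ^+ a.+1 = J *m J ^+ a.
Proof. by rewrite exprS mulmxE. Qed.

Lemma sign_mulK (K : fieldType) (e : K) : e = 1 \/ e = -1 -> e * e = 1.
Proof. by case=> ->; rewrite ?mulrNN mulr1. Qed.

Lemma sign_mul (K : fieldType) (e1 e2 : K) :
  e1 = 1 \/ e1 = -1 -> e2 = 1 \/ e2 = -1 -> e1 * e2 = 1 \/ e1 * e2 = -1.
Proof. by case=> ->; case=> ->; rewrite ?mulrNN ?mulr1 ?mul1r; auto. Qed.

Lemma sign_exp (K : fieldType) (e : K) (a : nat) :
  e = 1 \/ e = -1 -> e ^+ a = 1 \/ e ^+ a = -1.
Proof.
move=> he; elim: a => [|a IH]; first by left.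
by rewrite exprS; exact: sign_mul.
Qed.

Lemma sign_even (K : fieldType) (e : K) (a : nat) :
  e = 1 \/ e = -1 -> ~~ odd a -> e ^+ a = 1.
Proof.
move=> /sign_mulK he /even_halfK <-.
by rewrite -mul2n exprM expr2 he expr1n.
Qed.

(** * The star operation over both base fields *)

Lemma conj_scalar_zmod_morphism (R : realType) (b : base_field) :
  zmod_morphism (@conj_scalar R b).
Proof. by case: b => // x y; exact: (rmorphB (@conjc R)). Qed.

Lemma conj_scalar_monoid_morphism (R : realType) (b : base_field) :
  monoid_morphism (@conj_scalar R b).
Proof.
case: b => //; split; first exact: (rmorph1 (@conjc R)).
by move=> x y; exact: (rmorphM (@conjc R)).
Qed.

(** As a ring morphism, conjugation feeds the [map_mx] lemmas without a case split on the base
    field. *)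
HB.instance Definition _ (R : realType) (b : base_field) :=
  GRing.isZmodMorphism.Build _ _ (@conj_scalar R b)
    (@conj_scalar_zmod_morphism R b).

HB.instance Definition _ (R : realType) (b : base_field) :=
  GRing.isMonoidMorphism.Build _ _ (@conj_scalar R b)
    (@conj_scalar_monoid_morphism R b).

Lemma starD (R : realType) (b : base_field) (s : star_kind) (m n : nat)
  (A B : 'M[scalar_field R b]_(m, n)) : star s (A + B) = star s A + star s B.
Proof. by case: s; rewrite /= linearD //= map_mxD. Qed.

Lemma star0 (R : realType) (b : base_field) (s : star_kind) (m n : nat) :
  star s (0 : 'M[scalar_field R b]_(m, n)) = 0.
Proof. by apply: (addrI (star s 0)); rewrite -starD !addr0. Qed.

Lemma starN (R : realType) (b : base_field) (s : star_kind) (m n : nat)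
  (A : 'M[scalar_field R b]_(m, n)) : star s (- A) = - star s A.
Proof. by apply: (addrI (star s A)); rewrite -starD !subrr star0. Qed.

Lemma star_sum (R : realType) (b : base_field) (s : star_kind) (m n : nat)
  (I : Type) (r : seq I) (P : pred I) (F : I -> 'M[scalar_field R b]_(m, n)) :
  star s (\sum_(i <- r | P i) F i) = \sum_(i <- r | P i) star s (F i).
Proof. by apply: big_morph => [A B|]; [exact: starD|exact: star0]. Qed.

Lemma starM (R : realType) (b : base_field) (s : star_kind) (m n q : nat)
  (A : 'M[scalar_field R b]_(m, n)) (B : 'M[scalar_field R b]_(n, q)) :
  star s (A *m B) = star s B *m star s A.
Proof. by case: s; rewrite /= trmx_mul // map_mxM. Qed.

Lemma starK (R : realType) (b : base_field) (s : star_kind) (m n : nat)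
  (A : 'M[scalar_field R b]_(m, n)) : star s (star s A) = A.
Proof.
rewrite /star; case: s; last by rewrite trmxK.
case: b A => A; apply/matrixP=> i j; rewrite !mxE //=.
exact: conjcK.
Qed.

Lemma star1 (R : realType) (b : base_field) (s : star_kind) (m : nat) :
  star s (1%:M : 'M[scalar_field R b]_m) = 1%:M.
Proof.
by rewrite -[LHS]mul1mx -{1}[1%:M](starK s) -starM mul1mx starK.
Qed.

Lemma starX (R : realType) (b : base_field) (s : star_kind) (m a : nat)
  (A : 'M[scalar_field R b]_m) : star s (A ^+ a) = star s A ^+ a.
Proof.
elim: a => [|a IH]; first by rewrite !expr0 star1.
by rewrite mxexprS starM IH mxexprSr.
Qed.

(** Restricted to signs, since a Hermitian star conjugates a general scalar. *)
Lemma starZ (R : realType) (b : base_field) (s : star_kind) (m n : nat)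
  (e : scalar_field R b) (A : 'M[scalar_field R b]_(m, n)) :
  e = 1 \/ e = -1 -> star s (e *: A) = e *: star s A.
Proof. by case=> ->; rewrite ?scaleN1r ?scale1r ?starN. Qed.

(** * The stacked matrix X_L *)

Lemma unitmx_castmx (K : fieldType) (m n : nat) (e : m = n) (A : 'M[K]_m) :
  (castmx (e, e) A \in unitmx) = (A \in unitmx).
Proof. by case: n / e. Qed.

Lemma mulmx_stackL (K : fieldType) (k n q : nat) (X : 'M[K]_(n, k * n))
  (J : 'M[K]_(k * n)) (Y : 'M[K]_(k * n, q)) :
  stackL X J *m Y =
  castmx (sum_block_sizes k n, erefl q) (\mxcol_(i < k) (X *m J ^+ i *m Y)).
Proof.
rewrite /stackL -mxcol_mul; move: (\mxcol_i _) => M.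
by case: _ / (sum_block_sizes k n) in X J Y M *; rewrite !castmx_id.
Qed.

(** The blocks of [C *m invmx (stackL X J)] serve as coefficients. *)
Lemma stackL_span (K : fieldType) (k n q : nat) (X : 'M[K]_(n, k * n))
  (J : 'M[K]_(k * n)) (C : 'M[K]_(q, k * n)) :
  stackL X J \in unitmx ->
  exists Z : 'I_k -> 'M[K]_(q, n), C = \sum_i Z i *m X *m J ^+ i.
Proof.
move=> uL; pose D := castmx (erefl q, esym (sum_block_sizes k n))
  (C *m invmx (stackL X J)).
exists (fun i => submxrow D i).
under eq_bigr do rewrite -mulmxA.
rewrite -mul_mxrow_mxcol submxrowK -[LHS](mulmxKV uL) -/D.
rewrite /D /stackL; move: (invmx _) => V.
move: (\mxcol_i _) => M; move: (C *m V) => W.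
by case: _ / (sum_block_sizes k n) in W M *; rewrite !castmx_id.
Qed.

Lemma stackL_solve (K : fieldType) (k n q : nat) (X : 'M[K]_(n, k * n))
  (J : 'M[K]_(k * n)) (W : 'I_k -> 'M[K]_(n, q)) :
  stackL X J \in unitmx ->
  exists Y : 'M[K]_(k * n, q), forall i : 'I_k, X *m J ^+ i *m Y = W i.
Proof.
move=> uL; pose D := castmx (sum_block_sizes k n, erefl q) (\mxcol_i W i).
exists (invmx (stackL X J) *m D).
have := mulmx_stackL X J (invmx (stackL X J) *m D).
rewrite mulKVmx // => /(can_inj (castmxK _ _)) /eq_mxcolP h i.
by rewrite h.
Qed.

Lemma stackL_eq0 (K : fieldType) (k n q : nat) (X : 'M[K]_(n, k * n))
  (J : 'M[K]_(k * n)) (Y : 'M[K]_(k * n, q)) :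
  stackL X J \in unitmx ->
  (forall i : 'I_k, X *m J ^+ i *m Y = 0) -> Y = 0.
Proof.
move=> uL hY; have [Z hZ] := stackL_span 1%:M uL.
rewrite -[Y]mul1mx hZ mulmx_suml big1 // => i _.
by rewrite -2!mulmxA [X in Z i *m X]mulmxA hY mulmx0.
Qed.

(** * The matrix G and its symmetries *)

(** Multiplying G by J shifts one index. The hypothesis clears the last column of the shifted array,
    so only row 0 separates it from the full square. *)
Lemma big_sum_shift (V : zmodType) (k : nat) (t : nat -> nat -> V) :
  (forall a, t a.+1 k = 0) ->
  \sum_(a < k) \sum_(b < k) t a.+1 b =
  \sum_(a < k.+1) \sum_(b < k.+1) t a b - \sum_(b < k.+1) t 0 b.
Proof.
move=> h; rewrite [in RHS]big_ord_recl addrAC subrr add0r.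
by apply: eq_bigr => a _; rewrite lift0 big_ord_recr /= h addr0.
Qed.

(** With L the stack of the X J^i, this is L' H L for the block Hankel matrix H with blocks eps^i
    c_(i+j+1). *)
Definition alt_hankel (R : realType) (b : base_field) (s : star_kind)
    (e : scalar_field R b) (k n m : nat) (c : nat -> 'M[scalar_field R b]_n)
    (X : 'M[scalar_field R b]_(n, m)) (J : 'M[scalar_field R b]_m) :
    'M[scalar_field R b]_m :=
  \sum_(i < k) \sum_(j < k)
    e ^+ i *: (star s J ^+ i *m star s X *m c (i + j).+1 *m X *m J ^+ j).

Section AltHankel.

Variables (R : realType) (b : base_field) (s : star_kind).
Let K := scalar_field R b.
Variables (e1 e : K) (k n m : nat) (c : nat -> 'M[K]_n).
Variables (X : 'M[K]_(n, m)) (J : 'M[K]_m).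
Hypothesis he : e = 1 \/ e = -1.
Hypothesis csym : forall i, star s (c i) = (e1 * e ^+ i.+1) *: c i.
Hypothesis c0 : forall i, (k < i)%N -> c i = 0.
Hypothesis cXJ : \sum_(i < k.+1) c i *m X *m J ^+ i = 0.

Let G := alt_hankel s e k c X J.

(** Star exchanges i and j, and the sign eps^i e1 eps^(i+j+2) collapses to e1 eps^j because eps^2 =
    1. *)
Lemma star_alt_hankel : star s G = e1 *: G.
Proof.
rewrite /G /alt_hankel star_sum scaler_sumr.
under eq_bigr do rewrite star_sum.
rewrite exchange_big /=; apply: eq_bigr => i _.
rewrite scaler_sumr; apply: eq_bigr => j _.
rewrite starZ; last exact: sign_exp.
rewrite !starM csym !starX !starK !mulmxA addnC -!scalemxAr -!scalemxAl.
rewrite !scalerA; congr (_ *: _); rewrite 2!exprS exprD.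
have hj := sign_mulK (sign_exp j he); have h := sign_mulK he.
by ring: hj h.
Qed.

(* Both sides sum the same array t i j over i + j <= k, except for one missing
   border row or column, and each of these vanishes by [cXJ]. *)
Lemma alt_hankel_comm : star s J *m G = e *: (G *m J).
Proof.
pose t (i j : nat) :=
  e ^+ i *: (star s J ^+ i *m star s X *m c (i + j) *m X *m J ^+ j).
have t0 i j : (k < i + j)%N -> t i j = 0.
  by move=> /c0 h; rewrite /t h mulmx0 !mul0mx scaler0.
have l0 : star s J *m G = e *: \sum_(i < k) \sum_(j < k) t i.+1 j.
  rewrite /G /alt_hankel mulmx_sumr scaler_sumr; apply: eq_bigr => i _.
  rewrite mulmx_sumr scaler_sumr; apply: eq_bigr => j _.
  by rewrite /t scalerA exprS mulrA sign_mulK // mul1r mxexprS addSn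
             -scalemxAr !mulmxA.
have r0 : G *m J = \sum_(j < k) \sum_(i < k) t i j.+1.
  rewrite exchange_big /G /alt_hankel mulmx_suml; apply: eq_bigr => i _.
  rewrite mulmx_suml; apply: eq_bigr => j _.
  by rewrite /t mxexprSr addnS -scalemxAl !mulmxA.
rewrite l0 r0; congr (_ *: _).
rewrite (big_sum_shift (t := t)); last by move=> a; rewrite t0 // addSn ltnS leq_addl.
rewrite (big_sum_shift (t := fun j i => t i j)); last first.
  by move=> a; rewrite t0 // addnS ltnS leq_addr.
rewrite [in RHS]exchange_big /=; congr (_ - _).
(* The border i = 0 is X' times [cXJ]. The border j = 0 becomes a multiple of [cXJ] after a star, as
   its sign eps^i e1 eps^(i+1) = e1 eps does not depend on i. *)
transitivity (0 : 'M[K]_m); last first.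
  apply: (can_inj (@starK R b s m m)); rewrite star0 star_sum.
  under eq_bigr => i _.
    rewrite /t starZ; last exact: sign_exp.
    rewrite addn0 expr0 mulmx1 !starM csym starX !starK.
    rewrite -scalemxAl -scalemxAr scalerA exprS mulrCA mulrA.
    rewrite [X in X *: _](_ : _ = e1 * e); last first.
      rewrite -!mulrA; congr (_ * _).
      by rewrite mulrCA sign_mulK ?mulr1 //; exact: sign_exp.
    rewrite mulmxA.
    over.
  rewrite -scaler_sumr; under eq_bigr do rewrite -!mulmxA.
  rewrite -mulmx_sumr; under eq_bigr do rewrite mulmxA.
  by rewrite cXJ mulmx0 scaler0.
rewrite /t; under eq_bigr do rewrite add0n expr0 scale1r mul1mx -!mulmxA.
rewrite -mulmx_sumr; under eq_bigr do rewrite mulmxA.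
by rewrite cXJ mulmx0.
Qed.

Lemma alt_hankel_exp i : star s J ^+ i *m G = e ^+ i *: (G *m J ^+ i).
Proof.
elim: i => [|i IH]; first by rewrite !expr0 scale1r mul1mx mulmx1.
rewrite mxexprSr -mulmxA alt_hankel_comm -scalemxAr mulmxA IH -scalemxAl.
by rewrite scalerA -exprS -mulmxA -mxexprSr.
Qed.

(** Only the term i = 0, j = k - 1 survives: Y kills smaller j, and for j = k - 1 any i > 0 calls
    for a coefficient beyond k. *)
Lemma mul_alt_hankel (Y : 'M[K]_(m, n)) :
  (0 < k)%N ->
  (forall r, (r < k.-1)%N -> X *m J ^+ r *m Y = 0) ->
  c k *m (X *m J ^+ k.-1 *m Y) = 1%:M -> G *m Y = star s X.
Proof.
case: k c0 @G cXJ => // p c0' G' _ _ /= hY0 hY.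
rewrite /G' /alt_hankel mulmx_suml big_ord_recl [X in _ + X]big1 ?addr0; last first.
  move=> i _; rewrite lift0 mulmx_suml big1 // => j _.
  rewrite -scalemxAl -!mulmxA; have [hj|hj] := ltnP j p.
    by rewrite (mulmxA X) hY0 // !mulmx0 scaler0.
  by rewrite c0' ?mul0mx ?mulmx0 ?scaler0 // -addnS addSn ltnS
             (leq_trans _ (leq_addl _ _)).
rewrite mulmx_suml big_ord_recr /= big1 ?add0r; last first.
  move=> j _; rewrite -scalemxAl -!mulmxA (mulmxA X) hY0 //.
  by rewrite !mulmx0 scaler0.
by rewrite add0n expr0 scale1r mul1mx -!mulmxA (mulmxA X) hY mulmx1.
Qed.

End AltHankel.

(** * Inverses of matrix polynomials as Laurent series *)

(** This reads off the coefficient of mu^(t-j) in P N = 1, where N is the series of the N_r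
    mu^-r. *)
Lemma left_inverse_coeff (K : fieldType) (n k : nat) (P N : nat -> 'M[K]_n) :
  (forall r, (r < k)%N -> N r = 0) -> P k *m N k = 1%:M ->
  (forall m, \sum_(i < k.+1) P i *m N (i + m.+1)%N = 0) ->
  forall t j, (t <= k)%N ->
  \sum_(i < k.+1) P i *m N (i + j - t)%N = (j == t)%:R%:M.
Proof.
move=> N0 PN rec t j tk; case: (ltngtP j t) => [jt|tj|->].
(* Even where the subtraction truncates, the index stays below k, since j < t <= k. *)
- rewrite big1 ?raddf0 // => i _; rewrite N0 ?mulmx0 //.
  by have := ltn_ord i; lia.
- rewrite mulr0n raddf0 -[RHS](rec (j - t).-1); apply: eq_bigr => i _.
  by rewrite prednK ?subn_gt0 // addnBA // ltnW.
- rewrite big_ord_recr /= addnK PN big1 ?add0r // => i _.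
  by rewrite addnK N0 ?mulmx0.
Qed.

Lemma right_inverse_coeff (K : fieldType) (n k : nat) (Q N : nat -> 'M[K]_n) :
  (forall r, (r < k)%N -> N r = 0) -> N k *m Q k = 1%:M ->
  (forall m, \sum_(i < k.+1) N (i + m.+1)%N *m Q i = 0) ->
  forall t i, (t <= k)%N ->
  \sum_(j < k.+1) N (j + i - t)%N *m Q j = (i == t)%:R%:M.
Proof.
move=> N0 NQ rec t i tk; apply: trmx_inj; rewrite tr_scalar_mx.
rewrite -(@left_inverse_coeff _ n k (fun j => (Q j)^T) (fun j => (N j)^T)) //.
- by rewrite linear_sum; apply: eq_bigr => j _ /=; rewrite trmx_mul.
- by move=> r /N0 ->; rewrite trmx0.
- by rewrite -trmx_mul NQ trmx1.
- move=> r; rewrite -[RHS]trmx0 -[in RHS](rec r) linear_sum.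
  by apply: eq_bigr => j _ /=; rewrite trmx_mul.
Qed.

(* With [N] the coefficients of a Laurent series in 1/mu, the hypotheses say
   P N = 1 = N Q, and the double sum is the coefficient of mu^t in P N Q. *)
Lemma inverse_coeff_unique (K : fieldType) (n k : nat) (P Q N : nat -> 'M[K]_n) :
  (forall r, (r < k)%N -> N r = 0) ->
  P k *m N k = 1%:M -> N k *m Q k = 1%:M ->
  (forall m, \sum_(i < k.+1) P i *m N (i + m.+1)%N = 0) ->
  (forall m, \sum_(i < k.+1) N (i + m.+1)%N *m Q i = 0) ->
  forall t, (t <= k)%N -> P t = Q t.
Proof.
move=> N0 PN NQ recP recQ t tk.
pose S := \sum_(i < k.+1) \sum_(j < k.+1) P i *m N (i + j - t)%N *m Q j.
have tk1 : (t < k.+1)%N by rewrite ltnS.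
transitivity S.
  rewrite /S (bigD1 (Ordinal tk1)) //= [X in _ + X]big1 ?addr0 => [|i it].
    under eq_bigr do rewrite -mulmxA addnC.
    rewrite -mulmx_sumr right_inverse_coeff // eqxx.
    by rewrite mulmx1.
  under eq_bigr do rewrite -mulmxA addnC.
  rewrite -mulmx_sumr right_inverse_coeff //.
  by rewrite (negbTE (it : i != t :> nat)) raddf0 mulmx0.
rewrite /S exchange_big (bigD1 (Ordinal tk1)) //= [X in _ + X]big1 ?addr0 => [|j jt].
  by rewrite -mulmx_suml left_inverse_coeff // eqxx mul1mx.
rewrite -mulmx_suml left_inverse_coeff //.
by rewrite (negbTE (jt : j != t :> nat)) raddf0 mul0mx.
Qed.

(** * Coefficients of the reversal and their sign law *)

(** For odd k, i and k - i have opposite parity: odd i gives e1, even i gives e1 eps = e2. *)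
Lemma structure_sign (K : fieldType) (e1 e2 : K) (k i : nat) :
  e1 = 1 \/ e1 = -1 -> e2 = 1 \/ e2 = -1 -> odd k -> (i <= k)%N ->
  (if odd (k - i) then e2 else e1) = e1 * (e1 * e2) ^+ i.+1.
Proof.
move=> h1 h2 ok ik; have h := sign_mul h1 h2.
rewrite oddB // ok /=; case: (boolP (odd i)) => oi /=.
  by rewrite sign_even ?mulr1 //= oi.
by rewrite exprS (sign_even h) // mulr1 mulrA sign_mulK // mul1r.
Qed.

Lemma sum_reversal (K : fieldType) (k n m : nat) (A : matpoly K k n)
  (X : 'M[K]_(n, m)) (J : 'M[K]_m) :
  \sum_(i < k.+1) reversal A i *m X *m J ^+ i =
  \sum_(i < k.+1) A (rev_ord i) *m X *m J ^+ i.
Proof. by apply: eq_bigr => i _; rewrite ffunE. Qed.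

(* Extending by zero beyond degree k lets the double sum of [alt_hankel] run
   over a full square of indices. *)
Definition rcoef (K : fieldType) (k n : nat) (A : matpoly K k n) (i : nat) :
    'M[K]_n := if (i <= k)%N then A (inord (k - i)) else 0.

Lemma rcoef_ord (K : fieldType) (k n : nat) (A : matpoly K k n) (i : 'I_k.+1) :
  rcoef A i = A (rev_ord i).
Proof.
rewrite /rcoef -ltnS ltn_ord; congr (A _); apply: val_inj.
by rewrite /= inordK ?subSS // ltnS leq_subr.
Qed.

Lemma rcoef_max (K : fieldType) (k n : nat) (A : matpoly K k n) :
  rcoef A k = A ord0.
Proof.
by rewrite /rcoef leqnn subnn; congr (A _); apply: val_inj; rewrite /= inordK.
Qed.

Lemma sum_rcoef (K : fieldType) (k n m : nat) (A : matpoly K k n)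
  (X : 'M[K]_(n, m)) (J : 'M[K]_m) :
  \sum_(i < k.+1) rcoef A i *m X *m J ^+ i =
  \sum_(i < k.+1) reversal A i *m X *m J ^+ i.
Proof. by apply: eq_bigr => i _; rewrite rcoef_ord ffunE. Qed.

(** Trades the parity split for a single sign law on the reversed index, the form required of [c] in
    the study of G. *)
Lemma structuredP (R : realType) (b : base_field) (s : star_kind)
  (e1 e2 : scalar_field R b) (k n : nat) (A : matpoly (scalar_field R b) k n) :
  e1 = 1 \/ e1 = -1 -> e2 = 1 \/ e2 = -1 -> odd k ->
  structured s e1 e2 A <->
  forall i, star s (rcoef A i) = (e1 * (e1 * e2) ^+ i.+1) *: rcoef A i.
Proof.
move=> h1 h2 ok; split=> h i.
  rewrite /rcoef; case: leqP => [ik|_]; last by rewrite star0 scaler0.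
  by rewrite h inordK ?ltnS ?leq_subr // -(structure_sign h1 h2 ok ik).
have := h (k - i)%N.
rewrite -(structure_sign h1 h2 ok (leq_subr i k)) (subKn (leq_ord i)).
rewrite /rcoef leq_subr (subKn (leq_ord i)).
by rewrite (_ : inord i = i) //; apply: val_inj; rewrite /= inordK.
Qed.

(** * The coefficient formulas *)

(** The power of J in term i is i + (k - 1 - j): below k - 1 for i < j, where the term vanishes, and
    equal to k - 1 at i = j, which isolates A_(k-j). *)
Lemma reversal_mul_markov (K : fieldType) (k n m : nat) (A : matpoly K k n)
  (X : 'M[K]_(n, m)) (J : 'M[K]_m) (Y : 'M[K]_(m, n)) (j : 'I_k.+1) :
  (j < k)%N ->
  (forall r, (r < k.-1)%N -> X *m J ^+ r *m Y = 0) ->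
  X *m J ^+ k.-1 *m Y *m A ord0 = 1%:M ->
  (\sum_(i < k.+1) reversal A i *m X *m J ^+ i)
    *m (J ^+ (k.-1 - j) *m Y *m A ord0) =
  A (rev_ord j) + \sum_(i < k.+1 | (j < i)%N)
    A (rev_ord i) *m X *m J ^+ (k - j + i - 1) *m Y *m A ord0.
Proof.
move=> jk h0 h1; rewrite sum_reversal mulmx_suml.
have E (i : 'I_k.+1) : A (rev_ord i) *m X *m J ^+ i *m
    (J ^+ (k.-1 - j) *m Y *m A ord0) =
    A (rev_ord i) *m (X *m J ^+ (k - j + i - 1) *m Y *m A ord0).
  have -> : (k - j + i - 1 = i + (k.-1 - j))%N by lia.
  by rewrite mxexprD !mulmxA.
rewrite (bigID (fun i : 'I_k.+1 => (j < i)%N)) /= addrC; congr (_ + _); last first.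
  by apply: eq_bigr => i _; rewrite E !mulmxA.
rewrite (bigD1 j) ?ltnn //= E big1 ?addr0 => [|i /andP[ij i_neq_j]].
  have -> : (k - j + j - 1 = k.-1)%N by lia.
  by rewrite h1 mulmx1.
rewrite E h0 ?mul0mx ?mulmx0 //.
by move: i_neq_j; rewrite -(inj_eq val_inj) /=; lia.
Qed.

Lemma inD_exp (R : realType) (b : base_field) (s : star_kind)
  (e : scalar_field R b) (m : nat) (J T : 'M[scalar_field R b]_m) (i : nat) :
  T *m star s J = e *: (J *m T) ->
  T *m star s J ^+ i = e ^+ i *: (J ^+ i *m T).
Proof.
move=> TJ; elim: i => [|i IH]; first by rewrite !expr0 scale1r mul1mx mulmx1.
rewrite mxexprSr mulmxA IH -scalemxAl -mulmxA TJ -scalemxAr scalerA.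
by rewrite -exprSr mulmxA -mxexprSr.
Qed.

(** The formula for j is the relation sum_i Q_i X J^i = 0 tested on the columns of J^(k-1-j) T
    X'. *)
Lemma formulasP (R : realType) (b : base_field) (s : star_kind)
  (e1 e2 : scalar_field R b) (k n : nat) (X : 'M[scalar_field R b]_(n, k * n))
  (J T : 'M[scalar_field R b]_(k * n)) (A : matpoly (scalar_field R b) k n) :
  (2 <= k)%N -> e1 = 1 \/ e1 = -1 -> e2 = 1 \/ e2 = -1 ->
  stackL X J \in unitmx -> admissible s e1 e2 X J T ->
  coefficient_formulas s X J T A <->
  A ord0 = invmx (X *m J ^+ (k - 1) *m T *m star s X) /\
  \sum_(i < k.+1) reversal A i *m X *m J ^+ i = 0.
Proof.
move=> hk h1 h2 uL [uT [_ TJ] uN N0].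
pose Y := T *m star s X.
have Y0 r : (r < k.-1)%N -> X *m J ^+ r *m Y = 0.
  by move=> hr; rewrite mulmxA N0 //; lia.
have [Z hZ] := stackL_span 1%:M uL.
(* Starring 1 = sum_i Z_i X J^i and moving T across the powers of J' gives T = sum_i eps^i J^i Y
   Z_i', so these columns span. *)
have span q (M : 'M_(q, k * n)) :
    (forall j, (j < k)%N -> M *m (J ^+ (k.-1 - j) *m Y) = 0) -> M = 0.
  move=> hM; apply: (can_inj (mulmxK uT)); rewrite mul0mx.
  rewrite -[LHS]mulmx1 -(star1 _ _ s) hZ star_sum mulmx_sumr big1 // => i _.
  rewrite !starM starX -!mulmxA (mulmxA T) (inD_exp _ TJ) -scalemxAl -scalemxAr.
  rewrite -mulmxA (mulmxA T) (mulmxA (J ^+ i)) (mulmxA M).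
  have := hM (k.-1 - i)%N; rewrite subKn; last by have := ltn_ord i; lia.
  move=> ->; last by have := ltn_ord i; lia.
  by rewrite mul0mx scaler0.
rewrite /coefficient_formulas.
split=> -[hA0 H]; split=> //.
  have B1 : X *m J ^+ k.-1 *m Y *m A ord0 = 1%:M.
    by rewrite hA0 /Y mulmxA -subn1 mulmxV.
  have uA : A ord0 \in unitmx by rewrite hA0 unitmx_inv.
  apply: span => j jk; apply: (can_inj (mulmxK uA)); rewrite mul0mx.
  have jk1 : (j < k.+1)%N by exact: ltnW.
  have := reversal_mul_markov (j := Ordinal jk1) jk Y0 B1.
  rewrite (H (Ordinal jk1) jk) -!mulmxA => ->.
  rewrite addrC; apply/eqP; rewrite subr_eq0; apply/eqP/eq_bigr => i _.
  by rewrite -!mulmxA.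
move=> j jk.
have B1 : X *m J ^+ k.-1 *m Y *m A ord0 = 1%:M.
  by rewrite hA0 /Y mulmxA -subn1 mulmxV.
have := reversal_mul_markov jk Y0 B1; rewrite H mul0mx => /esym /eqP.
rewrite addr_eq0 => /eqP ->; congr (- _).
by apply: eq_bigr => i _; rewrite /Y -!mulmxA.
Qed.

(** * From a structured polynomial to T *)

Lemma ex_admissible (R : realType) (b : base_field) (s : star_kind)
  (e1 e2 : scalar_field R b) (k n : nat) (X : 'M[scalar_field R b]_(n, k * n))
  (J : 'M[scalar_field R b]_(k * n)) (A : matpoly (scalar_field R b) k n) :
  (2 <= k)%N -> odd k -> e1 = 1 \/ e1 = -1 -> e2 = 1 \/ e2 = -1 ->
  solves_inverse_problem s e1 e2 X J A ->
  exists T, admissible s e1 e2 X J T /\ coefficient_formulas s X J T A.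
Proof.
move=> hk ok h1 h2 [/(structuredP _ _ h1 h2 ok) hA uA _ [uL hQ]].
have he := sign_mul h1 h2.
have c0 i : (k < i)%N -> rcoef A i = 0 by move=> ki; rewrite /rcoef leqNgt ki.
have hc : \sum_(i < k.+1) rcoef A i *m X *m J ^+ i = 0 by rewrite sum_rcoef.
pose G := alt_hankel s (e1 * e2) k (rcoef A) X J.
(* Y is prescribed through the values that X J^r T X' must take. *)
have [Y hY] := stackL_solve
  (fun i : 'I_k => if i == k.-1 :> nat then invmx (A ord0) else 0) uL.
have Y0 r : (r < k.-1)%N -> X *m J ^+ r *m Y = 0.
  move=> hr; have rk : (r < k)%N by lia.
  by rewrite (hY (Ordinal rk)) /= ltn_eqF.
have Y1 : X *m J ^+ k.-1 *m Y = invmx (A ord0).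
  have rk : (k.-1 < k)%N by lia.
  by rewrite (hY (Ordinal rk)) /= eqxx.
have GY : G *m Y = star s X.
  apply: mul_alt_hankel => //; first by lia.
  by rewrite rcoef_max Y1 mulmxV.
have [Z hZ] := stackL_span 1%:M uL.
have uG : G \in unitmx.
  (* Since G J^i Y = eps^i (J')^i X', G V is the starred expansion of the identity. *)
  pose V := \sum_(i < k) (e1 * e2) ^+ i *: (J ^+ i *m Y *m star s (Z i)).
  suff : G *m V = 1%:M by case/mulmx1_unit.
  rewrite -[RHS](star1 _ _ s) hZ star_sum mulmx_sumr; apply: eq_bigr => i _.
  rewrite !starM starX mulmxA -GY mulmxA.
  by rewrite (alt_hankel_exp he hA c0 hc) -scalemxAr -!scalemxAl !mulmxA.
exists (invmx G); have TX : invmx G *m star s X = Y by rewrite -GY mulKmx.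
have hT : admissible s e1 e2 X J (invmx G).
  split; first by rewrite unitmx_inv.
  - split.
      apply: (can_inj (mulmxK uG)); rewrite -scalemxAl mulVmx //.
      (* Writing 1 = e1 e1 leaves one e1 to turn G into its star, which then cancels against the
         star of the inverse. *)
      rewrite -[LHS]scale1r -[X in X *: _ = _](sign_mulK h1) -scalerA; congr (_ *: _).
      by rewrite scalemxAr -(star_alt_hankel k X J he hA) -starM mulmxV // star1.
    apply: (can_inj (mulmxK uG)); rewrite -mulmxA.
    rewrite (alt_hankel_comm he hA c0 hc) -scalemxAr mulKmx //.
    by rewrite -scalemxAl mulmxKV.
  - by rewrite -mulmxA TX subn1 Y1 unitmx_inv.
  - by move=> r hr; rewrite -mulmxA TX Y0 //; lia.
split=> //; apply/(formulasP A hk h1 h2 uL hT); split=> //.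
by rewrite -[in RHS]mulmxA TX subn1 Y1 invmxK.
Qed.

(** * From T to a structured polynomial *)

Lemma formulas_structured (R : realType) (b : base_field) (s : star_kind)
  (e1 e2 : scalar_field R b) (k n : nat) (X : 'M[scalar_field R b]_(n, k * n))
  (J T : 'M[scalar_field R b]_(k * n)) (A : matpoly (scalar_field R b) k n) :
  (2 <= k)%N -> odd k -> e1 = 1 \/ e1 = -1 -> e2 = 1 \/ e2 = -1 ->
  stackL X J \in unitmx -> admissible s e1 e2 X J T ->
  coefficient_formulas s X J T A -> structured s e1 e2 A.
Proof.
move=> hk ok h1 h2 uL hT /(formulasP A hk h1 h2 uL hT) [hA0 hQ].
have [uT [sT TJ] uN N0] := hT; have he := sign_mul h1 h2.
apply/structuredP => // t; set e := e1 * e2 in TJ he *.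
have [tk|tk] := leqP t k; last first.
  by rewrite /rcoef leqNgt tk star0 scaler0.
(* [N r] is the coefficient of mu^-r in X (mu - J)^-1 T X', hence the shift by one. *)
pose N r := if r is r'.+1 then X *m J ^+ r' *m T *m star s X else 0.
have starN r : star s (N r.+1) = (e1 * e ^+ r) *: N r.+1.
  rewrite /= !starM starX starK sT -!scalemxAl -!scalemxAr.
  by rewrite (mulmxA T) (inD_exp _ TJ) -scalemxAl -scalemxAr scalerA !mulmxA.
have Nk : N k = X *m J ^+ (k - 1) *m T *m star s X.
  by rewrite -[k in LHS](prednK (ltnW hk)) subn1.
(* Equality with this structured star is the sign law itself. *)
pose Q i := (e1 * e ^+ i.+1) *: star s (rcoef A i).
have hs i : e1 * e ^+ i = 1 \/ e1 * e ^+ i = -1.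
  by apply: sign_mul => //; exact: sign_exp.
suff AQ : rcoef A t = Q t.
  by rewrite [in RHS]AQ /Q scalerA sign_mulK ?scale1r.
have uA : A ord0 \in unitmx by rewrite hA0 unitmx_inv.
have rec r : \sum_(i < k.+1) rcoef A i *m N (i + r.+1)%N = 0.
  transitivity ((\sum_(i < k.+1) rcoef A i *m X *m J ^+ i) *m
                 (J ^+ r *m T *m star s X)); last by rewrite sum_rcoef hQ mul0mx.
  rewrite mulmx_suml; apply: eq_bigr => i _.
  by rewrite addnS /= mxexprD !mulmxA.
apply: (inverse_coeff_unique (N := N) (k := k)) => //.
- by case=> // r rk; rewrite /N N0 //; lia.
- by rewrite rcoef_max Nk hA0 mulVmx.
(* Both k - 1 and k + 1 are even, so every power of eps disappears. *)
- rewrite /Q rcoef_max -scalemxAr.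
  apply: (can_inj (@starK R b s n n)); rewrite star1 starZ // starM starK.
  have := starN k.-1; rewrite (prednK (ltnW hk)) => ->.
  rewrite -scalemxAr scalerA !(sign_even he) ?mulr1 ?sign_mulK //=.
  - by rewrite scale1r Nk hA0 mulVmx.
  - by rewrite -subn1 oddB ?ok // ltnW.
  - by rewrite ok.
(* The right recurrence is the star of the left one, up to the common sign eps^(r+1). *)
- move=> r; apply: (can_inj (@starK R b s n n)); rewrite star0 star_sum.
  rewrite -[RHS](scaler0 _ (e ^+ r.+1)) -[in RHS](rec r) scaler_sumr.
  apply: eq_bigr => i _.
  rewrite starM addnS starN /Q starZ // starK -scalemxAl -scalemxAr scalerA.
  congr (_ *: _); rewrite exprD !exprS.
  have hi := sign_mulK (sign_exp i he); have h := sign_mulK h1.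
  by ring: hi h.
Qed.

(** Expanding -A_0 X J^k in the rows of the X J^i yields the other coefficients at once, in place of
    the recursion. *)
Lemma ex_formulas (R : realType) (b : base_field) (s : star_kind)
  (e1 e2 : scalar_field R b) (k n : nat) (X : 'M[scalar_field R b]_(n, k * n))
  (J T : 'M[scalar_field R b]_(k * n)) :
  (2 <= k)%N -> e1 = 1 \/ e1 = -1 -> e2 = 1 \/ e2 = -1 ->
  stackL X J \in unitmx -> admissible s e1 e2 X J T ->
  exists A : matpoly (scalar_field R b) k n, coefficient_formulas s X J T A.
Proof.
move=> hk h1 h2 uL hT.
pose A0 := invmx (X *m J ^+ (k - 1) *m T *m star s X).
have [Z hZ] := stackL_span (- (A0 *m X *m J ^+ k)) uL.
pose A : matpoly _ k n :=
  (* [insub] fails only at j = 0, where k - j is not below k, so the default is A_0. *)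
  [ffun j => if insub (rev_ord j : nat) is Some i then Z i else A0].
exists A; apply/(formulasP A hk h1 h2 uL hT); split.
  by rewrite ffunE insubF //= subSS subn0 ltnn.
rewrite sum_reversal big_ord_recr /= ffunE rev_ordK insubF ?ltnn //.
apply/eqP; rewrite addrC addr_eq0 -[X in X == _]opprK hZ eqr_opp; apply/eqP/eq_bigr=> i _.
rewrite ffunE rev_ordK.
by rewrite (valK i : insub (widen_ord (leqnSn k) i : nat) = Some i).
Qed.

(** Descending induction on j, with m bounding k - j: the formula for A_(k-j) involves only A_0 and
    indices i > j. *)
Lemma formulas_unique (R : realType) (b : base_field) (s : star_kind)
  (k n : nat) (X : 'M[scalar_field R b]_(n, k * n))
  (J T : 'M[scalar_field R b]_(k * n)) (A B : matpoly (scalar_field R b) k n) :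
  coefficient_formulas s X J T A -> coefficient_formulas s X J T B -> A = B.
Proof.
move=> [A0 hA] [B0 hB].
suff h m (j : 'I_k.+1) : (k - j <= m)%N -> A (rev_ord j) = B (rev_ord j).
  by apply/ffunP=> j; rewrite -[j]rev_ordK; exact: (h _ _ (leqnn _)).
elim: m j => [|m IH] j hj; have [jk|kj] := ltnP j k.
- by exfalso; lia.
- have -> : rev_ord j = ord0 by apply: ord_inj => /=; lia.
  by rewrite A0 B0.
- rewrite hA // hB //; congr (- _); apply: eq_bigr => i ji.
  by rewrite IH ?A0 ?B0 //; lia.
- have -> : rev_ord j = ord0 by apply: ord_inj => /=; lia.
  by rewrite A0 B0.
Qed.

(** * Singularity of A_k and the equivalence *)

(** Let W = [cokermx J], so J W = 0. The relation times W leaves A_k X W = 0; if A_k were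
    invertible, X_L W = 0 would force W = 0 and J invertible. *)
Lemma standard_pair_singular (K : fieldType) (k n : nat)
  (X : 'M[K]_(n, k * n)) (J : 'M[K]_(k * n)) (A : matpoly K k n) :
  (0 < k)%N -> J \notin unitmx -> standard_pair X J (reversal A) ->
  A ord_max \notin unitmx.
Proof.
move=> hk nJ [uL hQ]; apply: contra nJ => uA.
have JW : J *m cokermx J = 0 by exact: mulmx_coker.
have JXW i : J ^+ i.+1 *m cokermx J = 0 by rewrite mxexprSr -mulmxA JW mulmx0.
have XW : X *m cokermx J = 0.
  apply: (can_inj (mulKmx uA)); rewrite mulmx0.
  have := congr1 (mulmxr (cokermx J)) hQ.
  rewrite sum_reversal /= mul0mx mulmx_suml big_ord_recl big1 ?addr0 => [|i _].
    rewrite expr0 mulmx1 (mulmxA (A ord_max) X (cokermx J)).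
    rewrite (_ : rev_ord ord0 = ord_max) //.
    by apply: ord_inj; rewrite /= subn1.
  by rewrite -mulmxA lift0 JXW mulmx0.
have /eqP : cokermx J = 0.
  apply: (stackL_eq0 uL) => -[[|i] ik] /=; last by rewrite -mulmxA JXW mulmx0.
  by rewrite expr0 mulmx1.
by rewrite cokermx_eq0 row_full_unit.
Qed.

Theorem theorem2p10 (R : realType) (b : base_field) (s : star_kind)
    (n k l : nat) (hn : (1 <= n)%N) (hk : (2 <= k)%N) (hkodd : odd k)
    (hl : (l < k * n)%N)
    (e1 e2 : scalar_field R b) (he1 : e1 = 1 \/ e1 = -1) (he2 : e2 = 1 \/ e2 = -1)
    (XF : 'M[scalar_field R b]_(n, l)) (Xinf : 'M[scalar_field R b]_(n, k * n - l))
    (JF : 'M[scalar_field R b]_l) (Jinf : 'M[scalar_field R b]_(k * n - l))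
    (hJF : JF \in unitmx)
    (hJinf : jordan_matrix Jinf)
    (hJinf0 : forall a : scalar_field R b, eigenvalue Jinf a <-> a = 0)
    (X : 'M[scalar_field R b]_(n, k * n)) (J : 'M[scalar_field R b]_(k * n))
    (hX : X = castmx (erefl n, subnKC (ltnW hl)) (row_mx XF Xinf))
    (hJ : J = castmx (subnKC (ltnW hl), subnKC (ltnW hl))
                (block_mx (invmx JF) 0 0 Jinf)) :
  [/\ (exists A : matpoly (scalar_field R b) k n,
         solves_inverse_problem s e1 e2 X J A)
      <->
      (stackL X J \in unitmx /\
       exists T : 'M[scalar_field R b]_(k * n), admissible s e1 e2 X J T),
      forall A : matpoly (scalar_field R b) k n,
        solves_inverse_problem s e1 e2 X J A ->
        exists T : 'M[scalar_field R b]_(k * n),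
          admissible s e1 e2 X J T /\ coefficient_formulas s X J T A
    & forall T : 'M[scalar_field R b]_(k * n),
        stackL X J \in unitmx -> admissible s e1 e2 X J T ->
        (exists! A : matpoly (scalar_field R b) k n,
           coefficient_formulas s X J T A) /\
        (forall A : matpoly (scalar_field R b) k n,
           coefficient_formulas s X J T A ->
           solves_inverse_problem s e1 e2 X J A)].
Proof.
(* The eigenvalue 0 of [Jinf] makes a diagonal block of J singular. *)
have nJ : J \notin unitmx.
  rewrite hJ unitmx_castmx unitmxE det_ublock.
  have /eigenvalueP [v /eqP hv v0] : eigenvalue Jinf 0 by apply/hJinf0.
  suff /eqP -> : \det Jinf == 0 by rewrite mulr0 unitr0.
  by apply/det0P; exists v => //; apply/eqP; rewrite -(scale0r v).
(* Shared by the converse of the equivalence and the last claim. *)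
have conv T A : stackL X J \in unitmx -> admissible s e1 e2 X J T ->
    coefficient_formulas s X J T A -> solves_inverse_problem s e1 e2 X J A.
  move=> uL hT hA; have [A0 hQ] := (formulasP A hk he1 he2 uL hT).1 hA.
  have sQ : standard_pair X J (reversal A) by [].
  split=> //; first exact: (formulas_structured hk hkodd he1 he2 uL hT hA).
    by have [_ _ uN _] := hT; rewrite A0 unitmx_inv.
  exact: (standard_pair_singular (ltnW hk) nJ sQ).
split.
- split=> [[A hA]|[uL [T hT]]].
    split; first by have [_ _ _ []] := hA.
    by have [T [hT _]] := ex_admissible hk hkodd he1 he2 hA; exists T.
  have [A hA] := ex_formulas hk he1 he2 uL hT.
  by exists A; exact: conv hA.
- by move=> A; exact: ex_admissible.
- move=> T uL hT; split; last by move=> A; exact: conv.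
  have [A hA] := ex_formulas hk he1 he2 uL hT.
  by exists A; split=> // B; exact: formulas_unique.
Qed.
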